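(* Let $I\subset\mathbb{R}$ be an open interval, $a,b\in I$ with $a<b$, and let $f:I\to\mathbb{R}$ be a twice differentiable mapping such that $f''$ is integrable on $[a,b]$. Let $0\le\lambda\le1$. Suppose that $|f''|$ is convex on $[a,b]$. Then the following hold. If $0\le\lambda\le\frac12$, then $$\left|(\lambda-1)f\left(\frac{a+b}{2}\right)-\lambda\frac{f(a)+f(b)}{2}+\frac{1}{b-a}\int_a^b f(x)\,dx\right|$$ $$\le\frac{(b-a)^2}{12}\left[\left(\lambda^4+(1+\lambda)(1-\lambda)^3+\frac{5\lambda-3}{4}\right)|f''(a)|+\left(\lambda^4+(2-\lambda)\lambda^3+\frac{1-3\lambda}{4}\right)|f''(b)|\right].$$ If $\frac12\le\lambda\le1$, then $$\left|(\lambda-1)f\left(\frac{a+b}{2}\right)-\lambda\frac{f(a)+f(b)}{2}+\frac{1}{b-a}\int_a^b f(x)\,dx\right|\le\frac{(b-a)^2(3\lambda-1)}{48}\left[|f''(a)|+|f''(b)|\right].$$ *)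

(* Defs.v *)
From mathcomp Require Import all_boot all_order all_algebra.
From mathcomp Require Import all_classical all_reals all_analysis.

Set Implicit Arguments.
Unset Strict Implicit.
Unset Printing Implicit Defensive.

Import numFieldNormedType.Exports.
Local Open Scope ring_scope.
Local Open Scope classical_set_scope.

(* [f] is total on [R], but as [I] is open, the values of [f], [f^`()] and
   [f^`(2)] on [I] depend only on the restriction of [f] to [I]. *)
Definition twice_derivable_on (R : realType) (I : set R) (f : R -> R) : Prop :=
  forall x, I x -> derivable f x 1 /\ derivable f^`() x 1.

(* Main.v *)
Require Import Defs.
From mathcomp Require Import all_boot all_order all_algebra.
From mathcomp Require Import all_classical all_reals all_analysis.
From mathcomp Require Import ring lra.

Import Order.TTheory GRing.Theory Num.Theory.
Import numFieldNormedType.Exports.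
Local Open Scope ring_scope.
Local Open Scope classical_set_scope.

(** Folding [a, b] at its midpoint m turns the statement into one about the
even function h(s) = f(m + s) + f(m - s) on [0, c], with c = (b - a) / 2.
Folding makes the bound on the second derivative constant: the points m + s
and m - s sum to a + b, and a convex function takes the largest sum over such
a pair at the endpoints, so |h''(s)| is at most K = |f''(a)| + |f''(b)|
([convex_function_symmetric_le]).  This is why both inequalities are
symmetric in the two endpoint values; in the first one, the two coefficients
are different ways of writing (1 - 3 lambda + 8 lambda^3) / 4.

Up to the factor b - a, the quantity to estimate is
  E = int_0^c h - (1 - lambda) c h(0) - lambda c h(c).
Integrating by parts twice and using h'(0) = 0 gives E = int_0^c k h'' with
the Peano kernel k(s) = (c - s) (p - s) / 2, p = (1 - 2 lambda) c.  Hence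
|E| <= K int_0^c |k|.  The kernel changes sign at s = p, which lies in [0, c] when
lambda <= 1/2; when lambda >= 1/2, p <= 0 and the kernel has constant sign on
[0, c].  This is the origin of the two cases ([midpoint_endpoint_remainder_le]).

The integral of k h'' never has to be formed: the integration by parts is an
explicit function A with A' = k h'', and the increments of A are bounded by
those of a function with derivative K |k| ([ler_norm_increment]).  The only
integral left is that of f itself, which is continuous and so has a primitive
([primitive_on_segment]). *)

(** If |F'| <= G' then both G - F and G + F are nondecreasing. *)
Lemma ler_norm_increment (R : realType) (F dF G dG : R -> R) (u v : R) :
  u <= v ->
  {in `[u, v]%R, forall s : R, is_derive s 1 F (dF s)} ->
  {in `[u, v]%R, forall s : R, is_derive s 1 G (dG s)} ->
  {in `[u, v]%R, forall s : R, `|dF s| <= dG s} ->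
  `|F v - F u| <= G v - G u.
Proof.
move=> uv dFE dGE dFG.
have mono (E dE : R -> R) :
    {in `[u, v]%R, forall s : R, is_derive s 1 E (dE s)} ->
    {in `[u, v]%R, forall s : R, 0 <= dE s} -> E u <= E v.
  move=> dEE dE0.
  have [|x xuv EE] := @MVT_segment R E dE u v uv
    (fun x xuv => dEE x (subset_itv_oo_cc xuv)).
    by apply: derivable_within_continuous => x /dEE [].
  by rewrite -subr_ge0 EE mulr_ge0 ?dE0 ?subr_ge0.
have GBF : (G - F) u <= (G - F) v.
  apply: (mono _ (fun s => dG s - dF s)) => s suv.
    by have := dFE _ suv; have := dGE _ suv => ? ?; exact: is_deriveB.
  by rewrite subr_ge0; move: (dFG _ suv); apply: le_trans; rewrite ler_norm.
have GDF : (G + F) u <= (G + F) v.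
  apply: (mono _ (fun s => dG s + dF s)) => s suv.
    by have := dFE _ suv; have := dGE _ suv => ? ?; exact: is_deriveD.
  by move: (dFG _ suv); rewrite ler_norml => /andP[+ _]; lra.
by move: GBF GDF; rewrite !fctE ler_norml => GBF GDF; apply/andP; split; lra.
Qed.

(** The primitive is the integral from a base point slightly to the left of a,
so that it is differentiable at both endpoints a and b in the two-sided
sense. *)
Lemma primitive_on_segment (R : realType) (I : set R) (a b : R) (f : R -> R) :
  open I -> is_interval I -> I a -> I b -> a < b ->
  (forall x, I x -> {for x, continuous f}) ->
  exists2 F : R -> R,
    {in `[a, b]%R, forall x : R, is_derive x 1 F (f x)} &
    \int[@lebesgue_measure R]_(x in `[a, b]) f x = F b - F a.
Proof.
move=> oI iI Ia Ib ab cf.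
have [e /= e0 [Iae Ibe]] : exists2 e : R, 0 < e & I (a - e) /\ I (b + e).
  have [ea /= ea0 Ha] := open_nbhs_nbhs (conj oI Ia).
  have [eb /= eb0 Hb] := open_nbhs_nbhs (conj oI Ib).
  exists (Num.min ea eb / 2); first by rewrite divr_gt0// lt_min ea0.
  have [m1 m2] : Num.min ea eb <= ea /\ Num.min ea eb <= eb.
    by rewrite !ge_min !lexx orbT.
  have m0 : 0 < Num.min ea eb by rewrite lt_min ea0.
  split; [apply: Ha|apply: Hb] => /=; rewrite ltr_norml; lra.
have cI x : a - e <= x <= b + e -> {for x, continuous f}.
  by move=> xab; apply: cf; exact: iI xab.
have intf : (@lebesgue_measure R).-integrable `[a - e, b + e] (EFin \o f).
  apply: continuous_compact_integrable; first exact: segment_compact.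
  by apply: continuous_in_subspaceT => x; rewrite inE/= in_itv/= => /cI.
pose F x := \int[@lebesgue_measure R]_(t in `[a - e, x]) f t.
have dF : {in `[a, b]%R, forall x : R, is_derive x 1 F (f x)}.
  move=> x; rewrite in_itv/= => /andP[ax xb].
  have [|||? <-] := @continuous_FTC1_closed R f (a - e) x (b + e) _ intf.
  - by lra.
  - by lra.
  - by apply: cI; lra.
  by rewrite derive1E; exact: derivableP.
exists F => //.
rewrite /Rintegral (@continuous_FTC2 _ f F a b)//.
- apply: continuous_in_subspaceT => x; rewrite inE/= in_itv/= => xab.
  by apply: cI; lra.
- have [dx cl cr] : [/\ {in `]a, b[%R, forall x, derivable F x 1},
      {for a, continuous F} & {for b, continuous F}].
    split.
    + by move=> x /subset_itv_oo_cc /dF [].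
    + apply/differentiable_continuous/derivable1_diffP.
      by have [|] := dF a; rewrite // in_itv/= lexx ltW.
    + apply/differentiable_continuous/derivable1_diffP.
      by have [|] := dF b; rewrite // in_itv/= lexx ltW.
  split => //; [exact: cvg_at_right_filter|exact: cvg_at_left_filter].
- by move=> x /subset_itv_oo_cc /dF [_ <-]; rewrite derive1E.
Qed.

(** Both g(x) and g(y) lie below the chord of g between a and b, and the
values of an affine function at points with sum a + b add up to the sum of its
values at a and b. *)
Lemma convex_function_symmetric_le (R : realType) (g : R -> R) (a b x y : R) :
  a < b -> convex_function (`[a, b]%classic : set R^o) g ->
  a <= x -> a <= y -> x + y = a + b -> g x + g y <= g a + g b.
Proof.
move=> ab cg ax ay xy.
have ba0 : b - a != 0 by rewrite subr_eq0 gt_eqF.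
have chord z : a <= z <= b ->
    g z <= (b - z) / (b - a) * g a + (z - a) / (b - a) * g b.
  move=> zab.
  have t01 : 0 <= (b - z) / (b - a) <= 1.
    rewrite divr_ge0 ?ler_pdivrMr ?subr_gt0//=; lra.
  have /= := cg (Itv01 (andP t01).1 (andP t01).2) a b.
  rewrite !inE/= !in_itv/= !lexx (ltW ab) => /(_ isT isT).
  rewrite /conv/= /unstable.onem/=.
  have onE : 1 - (b - z) / (b - a) = (z - a) / (b - a) by field.
  rewrite onE /GRing.scale/=.
  have -> // : (b - z) / (b - a) * a + (z - a) / (b - a) * b = z :> R by field.
  rewrite /conv/= /conv/= /unstable.onem/= /GRing.scale/= => /le_trans; apply.
  by rewrite onE.
have -> : g a + g b = ((b - x) / (b - a) * g a + (x - a) / (b - a) * g b) +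
    ((b - y) / (b - a) * g a + (y - a) / (b - a) * g b).
  have -> : y = a + b - x by rewrite -xy addrC addKr.
  by field.
by apply: lerD; apply: chord; lra.
Qed.

(** The error on [0, c] of the rule that weights the endpoints 0 and c of
an even function h by 1 - lambda and lambda.  The function H is a primitive of
h, while h1 and h2 are its first two derivatives; evenness enters only through
h1 0 = 0, which removes the boundary term of the integration by parts at 0.
The bounds are K times the integral of the absolute value of the kernel k. *)
Lemma midpoint_endpoint_remainder_le (R : realType)
    (H h h1 h2 : R -> R) (c lambda K : R) :
  0 < c -> 0 <= lambda -> h1 0 = 0 ->
  {in `[0, c]%R, forall s : R, is_derive s 1 H (h s)} ->
  {in `[0, c]%R, forall s : R, is_derive s 1 h (h1 s)} ->
  {in `[0, c]%R, forall s : R, is_derive s 1 h1 (h2 s)} ->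
  {in `[0, c]%R, forall s : R, `|h2 s| <= K} ->
  let E := H c - H 0 - (1 - lambda) * c * h 0 - lambda * c * h c in
  (lambda <= 1 / 2 ->
    `|E| <= c ^+ 3 * (1 - 3 * lambda + 8 * lambda ^+ 3) / 6 * K) /\
  (1 / 2 <= lambda -> `|E| <= c ^+ 3 * (3 * lambda - 1) / 6 * K).
Proof.
move=> c0 l0 h10 dH dh dh1 hK E.
pose p := (1 - 2 * lambda) * c.
(* The kernel is determined by k'' = 1, k c = 0 and the values of k' at 0 and
   c, which must produce the two weights of the rule.  Since k'' = 1, the
   derivative of A reduces to k * h2. *)
pose k s : R := (c - s) * (p - s) / 2.
pose k' s : R := s - (c + p) / 2.
pose A s := k s * h1 s - k' s * h s + H s.
pose P s : R := s ^+ 3 / 6 - (c + p) * s ^+ 2 / 4 + c * p * s / 2.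
have dk (s : R) : is_derive s 1 k (k' s).
  rewrite /k; apply: is_derive_eq.
  by rewrite /k' /GRing.scale/=; field.
have dk' (s : R) : is_derive s 1 k' 1.
  by rewrite /k'; apply: is_derive_eq; rewrite subr0.
have dP (s : R) : is_derive s 1 P (k s).
  rewrite /P; apply: is_derive_eq.
  by rewrite /k /GRing.scale/=; field.
have dA : {in `[0, c]%R, forall s : R, is_derive s 1 A (k s * h2 s)}.
  move=> s sc; have := dH _ sc; have := dh _ sc; have := dh1 _ sc => ? ? ?.
  rewrite /A; apply: is_derive_eq.
  by rewrite /GRing.scale/=; ring.
have AE : E = A c - A 0.
  by rewrite /E /A /k /k' /p h10; field.
(* Where k has constant sign e, a primitive of K * |k| is e * K * P. *)
have bound (e u v : R) : 0 <= u -> u <= v -> v <= c ->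
    {in `[u, v]%R, forall s : R, `|k s| = e * k s} ->
    `|A v - A u| <= e * K * (P v - P u).
  move=> u0 uv vc ke.
  have suvc (s : R) : s \in `[u, v]%R -> s \in `[0, c]%R.
    rewrite !in_itv/= => /andP[us sv].
    by rewrite (le_trans u0 us) (le_trans sv vc).
  have dQ : {in `[u, v]%R, forall s : R,
      is_derive s 1 ((e * K) \*: P) (`|k s| * K)}.
    move=> s suv; have := is_deriveZ (e * K) (dP s).
    by rewrite ke// mulrAC.
  have := @ler_norm_increment R _ _ _ _ _ _ uv
    (fun s suv => dA s (suvc s suv)) dQ.
  rewrite mulrBr; apply => s suv.
  by rewrite normrM ler_wpM2l//; apply/hK/suvc.
have posk s : s <= c -> s <= p -> `|k s| = 1 * k s.
  move=> sc sp; rewrite mul1r ger0_norm// /k divr_ge0// mulr_ge0//; lra.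
have negk s : s <= c -> p <= s -> `|k s| = - 1 * k s.
  move=> sc ps; rewrite mulN1r ler0_norm// /k pmulr_lle0 ?invr_gt0//.
  by rewrite mulr_ge0_le0//; lra.
have pc : p <= c by rewrite /p ler_piMl ?(ltW c0)//; lra.
split=> lhalf.
- have p0 : 0 <= p by rewrite /p mulr_ge0 ?(ltW c0)//; lra.
  have -> : E = (A p - A 0) + (A c - A p) by rewrite AE; ring.
  have b1 : `|A p - A 0| <= 1 * K * (P p - P 0).
    by apply: bound => // s; rewrite in_itv/= => sp; apply: posk; lra.
  have b2 : `|A c - A p| <= - 1 * K * (P c - P p).
    by apply: bound => // s; rewrite in_itv/= => sp; apply: negk; lra.
  apply: le_trans (ler_normD _ _) _; apply: le_trans (lerD b1 b2) _.
  by rewrite le_eqVlt; apply/predU1P; left; rewrite /P /p; field.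
- have p0 : p <= 0 by rewrite /p mulr_le0_ge0 ?(ltW c0)//; lra.
  rewrite AE.
  have /le_trans -> // : `|A c - A 0| <= - 1 * K * (P c - P 0).
    apply: bound => //; first exact: ltW.
    by move=> s; rewrite in_itv/= => sp; apply: negk; lra.
  by rewrite le_eqVlt; apply/predU1P; left; rewrite /P /p; field.
Qed.

Lemma is_derive_comp_addl (R : realType) (F : R -> R) (m s d : R) :
  is_derive (m + s) 1 F d -> is_derive s 1 (fun t => F (m + t)) d.
Proof.
move=> dF; have dm : is_derive s 1 (fun t : R => m + t) 1.
  by apply: is_derive_eq; ring.
by have := @is_derive1_comp R F (fun t => m + t) s _ _ dF dm; rewrite mulr1.
Qed.

Lemma is_derive_comp_subl (R : realType) (F : R -> R) (m s d : R) :
  is_derive (m - s) 1 F d -> is_derive s 1 (fun t => F (m - t)) (- d).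
Proof.
move=> dF; have dm : is_derive s 1 (fun t : R => m - t) (- 1).
  by apply: is_derive_eq; ring.
by have := @is_derive1_comp R F (fun t => m - t) s _ _ dF dm; rewrite mulrN1.
Qed.

Lemma is_derive_reflectD (R : realType) (F : R -> R) (m s dr dl : R) :
  is_derive (m + s) 1 F dr -> is_derive (m - s) 1 F dl ->
  is_derive s 1 (fun t => F (m + t) + F (m - t)) (dr - dl).
Proof.
by move=> /is_derive_comp_addl Fr /is_derive_comp_subl Fl; exact: is_deriveD.
Qed.

Lemma is_derive_reflectB (R : realType) (F : R -> R) (m s dr dl : R) :
  is_derive (m + s) 1 F dr -> is_derive (m - s) 1 F dl ->
  is_derive s 1 (fun t => F (m + t) - F (m - t)) (dr + dl).
Proof.
move=> /is_derive_comp_addl Fr /is_derive_comp_subl Fl.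
by rewrite -[dl]opprK; exact: is_deriveB.
Qed.

Theorem theorem4 (R : realType) (I : set R) (a b : R) (f : R -> R) (lambda : R)
  (I_open : open I) (I_itv : is_interval I)
  (Ia : I a) (Ib : I b) (ab : a < b)
  (df : twice_derivable_on I f)
  (intf'' : (@lebesgue_measure R).-integrable `[a, b] (EFin \o f^`(2)))
  (lambda_ge0 : 0 <= lambda) (lambda_le1 : lambda <= 1)
  (convf'' : convex_function (`[a, b]%classic : set R^o)
               (fun x => `|f^`(2) x|)) :
  (lambda <= 1 / 2 ->
    `| (lambda - 1) * f ((a + b) / 2) - lambda * ((f a + f b) / 2)
       + 1 / (b - a) * \int[@lebesgue_measure R]_(x in `[a, b]) f x |
    <= (b - a) ^+ 2 / 12 *
       ((lambda ^+ 4 + (1 + lambda) * (1 - lambda) ^+ 3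
           + (5 * lambda - 3) / 4) * `|f^`(2) a|
        + (lambda ^+ 4 + (2 - lambda) * lambda ^+ 3
           + (1 - 3 * lambda) / 4) * `|f^`(2) b|))
  /\
  (1 / 2 <= lambda ->
    `| (lambda - 1) * f ((a + b) / 2) - lambda * ((f a + f b) / 2)
       + 1 / (b - a) * \int[@lebesgue_measure R]_(x in `[a, b]) f x |
    <= (b - a) ^+ 2 * (3 * lambda - 1) / 48 *
       (`|f^`(2) a| + `|f^`(2) b|)).
Proof.
have cf x : I x -> {for x, continuous f}.
  by move=> /df[fx _]; apply/differentiable_continuous/derivable1_diffP.
have [F dF ->] := @primitive_on_segment R I a b f I_open I_itv Ia Ib ab cf.
pose m := (a + b) / 2; pose c := (b - a) / 2.
have c0 : 0 < c by rewrite /c; lra.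
have smallE (va vb : R) :
    c ^+ 3 * (1 - 3 * lambda + 8 * lambda ^+ 3) / 6 * (va + vb) =
    (b - a) ^+ 2 / 12 *
      ((lambda ^+ 4 + (1 + lambda) * (1 - lambda) ^+ 3
          + (5 * lambda - 3) / 4) * va
       + (lambda ^+ 4 + (2 - lambda) * lambda ^+ 3
          + (1 - 3 * lambda) / 4) * vb) * (b - a).
  by rewrite /c; field.
have largeE (va vb : R) :
    c ^+ 3 * (3 * lambda - 1) / 6 * (va + vb) =
    (b - a) ^+ 2 * (3 * lambda - 1) / 48 * (va + vb) * (b - a).
  by rewrite /c; field.
have ba0 : b - a != 0 by rewrite subr_eq0 gt_eqF.
have mc : m + c = b by rewrite /m /c; field.
have mNc : m - c = a by rewrite /m /c; field.
have mpm s : s \in `[0, c]%R -> m + s \in `[a, b]%R /\ m - s \in `[a, b]%R.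
  by rewrite /m /c !in_itv/=; lra.
have df1 : {in `[a, b]%R, forall x : R, is_derive x 1 f (f^`() x)}.
  move=> x xab; have [fx _] : derivable f x 1 /\ derivable f^`() x 1.
    by apply/df/(I_itv a b).
  by rewrite derive1E; exact: derivableP.
have df2 : {in `[a, b]%R, forall x : R, is_derive x 1 f^`() (f^`(2) x)}.
  move=> x xab; have [_ fx] : derivable f x 1 /\ derivable f^`() x 1.
    by apply/df/(I_itv a b).
  by rewrite [f^`(2) x]derive1E; exact: derivableP.
have /= [||||||bl br] := @midpoint_endpoint_remainder_le R
  (fun s => F (m + s) - F (m - s)) (fun s => f (m + s) + f (m - s))
  (fun s => f^`()%classic (m + s) - f^`()%classic (m - s))
  (fun s => f^`(2)%classic (m + s) + f^`(2)%classic (m - s))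
  c lambda (`|f^`(2)%classic a| + `|f^`(2)%classic b|) c0.
- by [].
- by rewrite addr0 subr0 subrr.
- by move=> s /mpm[rs ls]; apply: is_derive_reflectB; exact: dF.
- by move=> s /mpm[rs ls]; apply: is_derive_reflectD; exact: df1.
- by move=> s /mpm[rs ls]; apply: is_derive_reflectB; exact: df2.
- move=> s /mpm[]; rewrite !in_itv/= => /andP[ra rb] /andP[la lb].
  apply: le_trans (ler_normD _ _) _.
  apply: (@convex_function_symmetric_le _
    (fun x => `|f^`(2)%classic x|) a b) => //.
  by rewrite /m; field.
(* E is the remainder of the folded function on [0, c], which is b - a times
   the quantity to bound. *)
move: bl br; rewrite mc mNc !addr0 !subr0 subrr subr0.
set E := F b - F a - _ - _ => bl br.
rewrite (_ : _ + _ = E / (b - a)); last by rewrite /E /m /c; field.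
rewrite normrM normfV (gtr0_norm (_ : 0 < b - a)) ?subr_gt0//.
split=> [/bl|/br]; rewrite ler_pdivrMr ?subr_gt0// => /le_trans; apply.
- by rewrite le_eqVlt; apply/predU1P; left; exact: smallE.
- by rewrite le_eqVlt; apply/predU1P; left; exact: largeE.
Qed.
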